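(* Let $n\ge1$, let $H\in\mathbb{R}^{n\times n}$ be symmetric positive definite and $Q^*\in\mathbb{R}$ (both unknown). Given any $\sigma_0>0$, any integer $D_M\ge1$ and any positive tuning parameters $a_1,\dots,a_n,k$, there exist sufficiently small tuning parameters $\varepsilon>0$ and $\omega_i=O(\sqrt\varepsilon)$, $i=1,\dots,n$, such that the classical extremum seeking estimation error system $$\tilde\theta(j+1)=\tilde\theta(j)-\varepsilon kM(j)\Big[Q^*+\tfrac12\big|\tilde\theta(j-D(j))+S(j-D(j))\big|_H^2\Big],\quad j\ge D_M,$$ with $\tilde\theta(j)=\tilde\theta(0)\in\mathbb{R}^n$ and $|\tilde\theta(j)|\le\sigma_0$ for $0\le j\le D_M$, and with unknown time-varying delay $D(j)\in\mathbb{Z}$, $0\le D(j)\le D_M$, is practically stable (in the sense given in the context, with $M,S,\omega_i$ defined there).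
   Context: Notation: $|\cdot|$ is the Euclidean norm; $|x|_H^2=x^THx$; $\lfloor\cdot\rfloor$ is the floor; time $j$ runs over nonnegative integers. Dithers: $T=\max\{nD_M\lfloor1/\sqrt\varepsilon\rfloor,\,2n+1\}$, $\omega_i=2\pi i/T$ (so $\omega_i=O(\sqrt\varepsilon)$ as $\varepsilon\to0$), $S(j)\in\mathbb{R}^n$ has components $S_i(j)=a_i\sin(\omega_ij)$, and $M(j)\in\mathbb{R}^n$ has components $M_i(j)=\frac{2}{a_i}\sin(\omega_ij)$. The system is the error dynamics, $\tilde\theta=\hat\theta-\theta^*$, of the algorithm $\hat\theta(j+1)=\hat\theta(j)-\varepsilon kM(j)y(j)$ seeking the minimizer $\theta^*$ of the map $Q(\theta)=Q^*+\frac12|\theta-\theta^*|_H^2$ from delayed measurements $y(j)=Q(\theta(j-D(j)))$. Practically stable for sufficiently small $\varepsilon$ (with respect to the initial ball of radius $\sigma_0$) means: there exist $\varepsilon^*>0$, $\sigma>\sigma_0$ and $C>0$ such that for every $\varepsilon\in(0,\varepsilon^*]$ all solutions, for all admissible delays, satisfy $|\tilde\theta(j)|<\sigma$ for all $j\ge D_M$ and are exponentially attracted to the ball $\{x\in\mathbb{R}^n:|x|<C\sqrt\varepsilon\}$ (i.e., their distance to this ball is bounded by $C'r^j$ for some $C'>0$, $r\in(0,1)$ that may depend on $\varepsilon$). *)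

(* Defs.v *)
From HB Require Import structures.
From mathcomp Require Import all_boot all_order all_algebra.
From mathcomp Require Import all_classical all_reals all_analysis.
Set Implicit Arguments.
Unset Strict Implicit.
Unset Printing Implicit Defensive.
Import Order.TTheory GRing.Theory Num.Theory.
Import numFieldNormedType.Exports.
Local Open Scope classical_set_scope.
Local Open Scope ring_scope.

(* The norm `|x| that MathComp-Analysis puts on matrices is the sup norm, so
   the Euclidean norm, its balls and the distance to a set are defined here. *)
Definition enorm (R : realType) (n : nat) (x : 'cV[R]_n) : R :=
  Num.sqrt (\sum_i x i 0 ^+ 2).

Definition eball (R : realType) (n : nat) (r : R) : set 'cV[R]_n :=
  [set x | enorm x < r].

Definition edist_set (R : realType) (n : nat) (x : 'cV[R]_n)
    (A : set 'cV[R]_n) : R :=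
  inf [set enorm (x - y) | y in A].

(* The squared weighted norm |x|_H^2. *)
Definition qform (R : realType) (n : nat) (H : 'M[R]_n) (x : 'cV[R]_n) : R :=
  (x^T *m H *m x) 0 0.

Definition sym_posdef (R : realType) (n : nat) (H : 'M[R]_n) : Prop :=
  H^T = H /\ forall x : 'cV[R]_n, x != 0 -> 0 < qform H x.

Definition dither_period (R : realType) (n DM : nat) (eps : R) : int :=
  Num.max ((n * DM)%:Z * Num.floor (1 / Num.sqrt eps)) (2 * n + 1)%:Z.

(* Indices i : 'I_n start at 0, whence i.+1. *)
Definition omega (R : realType) (n DM : nat) (i : 'I_n) (eps : R) : R :=
  2 * pi * i.+1%:R / (dither_period n DM eps)%:~R.

Definition S_dither (R : realType) (n DM : nat) (a : 'I_n -> R) (eps : R)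
    (j : nat) : 'cV[R]_n :=
  \col_i (a i * sin (omega DM i eps * j%:R)).

Definition M_dither (R : realType) (n DM : nat) (a : 'I_n -> R) (eps : R)
    (j : nat) : 'cV[R]_n :=
  \col_i (2 / a i * sin (omega DM i eps * j%:R)).

(* The recursion is only imposed for DM <= j, where D j <= DM <= j, so the
   subtraction j - D j on nat is never truncated. *)
Definition es_solution (R : realType) (n : nat) (H : 'M[R]_n) (Qstar : R)
    (sigma0 : R) (DM : nat) (a : 'I_n -> R) (k eps : R) (D : nat -> nat)
    (theta : nat -> 'cV[R]_n) : Prop :=
  [/\ forall j, (j <= DM)%N -> theta j = theta 0%N,
      forall j, (j <= DM)%N -> enorm (theta j) <= sigma0
    & forall j, (DM <= j)%N ->
        theta j.+1 = theta j -
          (eps * k * (Qstar + 1 / 2 *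
             qform H (theta (j - D j)%N + S_dither DM a eps (j - D j)%N)))
          *: M_dither DM a eps j].

Definition es_solutions (R : realType) (n : nat) (H : 'M[R]_n) (Qstar : R)
    (sigma0 : R) (DM : nat) (a : 'I_n -> R) (k eps : R) :
    set (nat -> 'cV[R]_n) :=
  [set theta | exists D : nat -> nat, (forall j, (D j <= DM)%N) /\
     es_solution H Qstar sigma0 DM a k eps D theta].

(* sol eps is the set of all solutions, over all admissible delays, for the
   parameter eps; the rate constants C' and r may depend on eps but are
   uniform over sol eps. *)
Definition practically_stable (R : realType) (n DM : nat) (sigma0 : R)
    (sol : R -> set (nat -> 'cV[R]_n)) : Prop :=
  exists eps_star sigma C : R,
    [/\ 0 < eps_star, sigma0 < sigma, 0 < C
      & forall eps : R, 0 < eps <= eps_star ->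
        (forall theta, sol eps theta ->
           forall j, (DM <= j)%N -> enorm (theta j) < sigma) /\
        (exists C' r : R, [/\ 0 < C', 0 < r < 1
           & forall theta, sol eps theta -> forall j : nat,
               edist_set (theta j) (@eball R n (C * Num.sqrt eps))
                 <= C' * r ^+ j])].

(* Main.v *)
(* Over one dither period T ~ 1/sqrt eps the averages of M_j S_j^T, M_j and
   M_j |S_j|_H^2 are I, 0 and 0, so with the iterate and the delay frozen the
   error is mapped exactly to (I - eps k T H) theta. Since eps T = O(sqrt eps)
   and the dither frequencies are O(sqrt eps), freezing perturbs the output by
   only O(sqrt eps), whatever the delays are. Sampled once per period, the norm
   therefore contracts by 1 - eps k T lam / 2 up to an O(sqrt eps) multiple of
   the contraction gap, and it moves by O(sqrt eps) inside a period. *)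
Require Import Defs.
From mathcomp Require Import all_boot all_order all_algebra.
From mathcomp Require Import ring lra.
From mathcomp Require Import all_classical all_reals all_analysis.
Import Order.TTheory GRing.Theory Num.Theory.
Import numFieldNormedType.Exports.
Set Implicit Arguments.
Unset Strict Implicit.
Unset Printing Implicit Defensive.
Local Open Scope classical_set_scope.
Local Open Scope ring_scope.

(** * Quadratic forms and the Euclidean norm *)

Section bilinear.
Variables (R : realType) (n : nat).
Implicit Types (A H : 'M[R]_n) (x y z : 'cV[R]_n).

(** A single form serves for both the weighted product and, at [A = 1%:M], the Euclidean one, so
    Cauchy-Schwarz is proved only once. *)
Definition bil A x y : R := (x^T *m A *m y) 0 0.

Lemma bilDl A x y z : bil A (x + y) z = bil A x z + bil A y z.
Proof. by rewrite /bil raddfD !mulmxDl mxE. Qed.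

Lemma bilDr A x y z : bil A z (x + y) = bil A z x + bil A z y.
Proof. by rewrite /bil mulmxDr mxE. Qed.

Lemma bilZl A c x y : bil A (c *: x) y = c * bil A x y.
Proof. by rewrite /bil linearZ -!scalemxAl mxE. Qed.

Lemma bilZr A c x y : bil A x (c *: y) = c * bil A x y.
Proof. by rewrite /bil -scalemxAr mxE. Qed.

Lemma bilNl A x y : bil A (- x) y = - bil A x y.
Proof. by rewrite -scaleN1r bilZl mulN1r. Qed.

Lemma bilNr A x y : bil A x (- y) = - bil A x y.
Proof. by rewrite -scaleN1r bilZr mulN1r. Qed.

Lemma bil0l A x : bil A 0 x = 0.
Proof. by rewrite -(scale0r 0) bilZl mul0r. Qed.

Lemma bil0r A x : bil A x 0 = 0.
Proof. by rewrite -(scale0r 0) bilZr mul0r. Qed.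

Lemma bilC A x y : A^T = A -> bil A x y = bil A y x.
Proof.
move=> sA; rewrite /bil -[LHS](mxE trmx_key (fun i j => (x^T *m A *m y) j i)).
by rewrite -/(trmx _) !trmx_mul trmxK sA mulmxA.
Qed.

Lemma bilE A x y : bil A x y = \sum_i \sum_j x i 0 * A i j * y j 0.
Proof.
rewrite /bil mxE exchange_big; apply: eq_bigr => j _ /=.
by rewrite mxE mulr_suml; apply: eq_bigr => i _; rewrite mxE.
Qed.

Lemma bil1E x y : bil 1%:M x y = \sum_i x i 0 * y i 0.
Proof. by rewrite /bil mulmx1 mxE; apply: eq_bigr => i _; rewrite mxE. Qed.

Lemma bil_mulmxr A x y : bil A x y = bil 1%:M x (A *m y).
Proof. by rewrite /bil mulmx1 mulmxA. Qed.

Lemma qformD H x y : H^T = H ->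
  qform H (x + y) = qform H x + bil H x y *+ 2 + qform H y.
Proof.
move=> sH; rewrite /qform -!/(bil _ _ _) !(bilDl, bilDr) (bilC y) //.
by rewrite mulr2n !addrA.
Qed.

Lemma qformN H x : qform H (- x) = qform H x.
Proof. by rewrite /qform -!/(bil _ _ _) bilNl bilNr opprK. Qed.

Lemma qformZ H c x : qform H (c *: x) = c ^+ 2 * qform H x.
Proof. by rewrite /qform -!/(bil _ _ _) bilZl bilZr mulrA expr2. Qed.

Lemma qform_ge0 H x : sym_posdef H -> 0 <= qform H x.
Proof.
move=> [_ pH]; have [->|x0] := eqVneq x 0; last exact/ltW/pH.
by rewrite /qform -/(bil _ _ _) bil0l.
Qed.

Lemma bil_CauchySchwarz H x y : sym_posdef H ->
  bil H x y ^+ 2 <= qform H x * qform H y.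
Proof.
move=> pdH; have [sH pH] := pdH.
have [->|y0] := eqVneq y 0.
  by rewrite bil0r expr0n /= {2}/qform -/(bil _ _ _) bil0l mulr0.
have qy := pH y y0.
(* The form at this vector equals [qform H y * (qform H x * qform H y - bil H x y ^+ 2)], and the
   first factor is positive. *)
have := qform_ge0 (qform H y *: x - bil H x y *: y) pdH.
rewrite qformD // qformN !qformZ bilNr bilZl bilZr => h.
rewrite -(ler_pM2l qy); nra.
Qed.

Lemma sym_posdef1 : sym_posdef (1%:M : 'M[R]_n).
Proof.
split=> [|x x0]; first exact: trmx1.
rewrite /qform -/(bil _ _ _) bil1E.
have sq_ge0 i : 0 <= x i 0 * x i 0 by rewrite -expr2 sqr_ge0.
rewrite lt_neqAle sumr_ge0 // andbT eq_sym.
apply: contra x0 => /eqP/psumr_eq0P-/(_ (fun i _ => sq_ge0 i)) x0.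
apply/eqP/matrixP => i j; rewrite !ord1 mxE.
by apply/eqP; rewrite -sqrf_eq0 expr2 x0.
Qed.

Lemma enorm_ge0 x : 0 <= enorm x.
Proof. exact: sqrtr_ge0. Qed.

Lemma sqr_enorm x : enorm x ^+ 2 = bil 1%:M x x.
Proof.
by rewrite bil1E sqr_sqrtr //; apply: sumr_ge0 => i _; rewrite sqr_ge0.
Qed.

Lemma enorm0 : enorm (0 : 'cV[R]_n) = 0.
Proof. by apply/eqP; rewrite -sqrf_eq0 sqr_enorm bil0l. Qed.

Lemma enormZ c x : enorm (c *: x) = `|c| * enorm x.
Proof.
apply: (pexpIrn (n := 2)); rewrite ?nnegrE ?enorm_ge0 //.
  by rewrite mulr_ge0 ?enorm_ge0.
by rewrite exprMn !sqr_enorm bilZl bilZr mulrA -expr2 real_normK ?num_real.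
Qed.

Lemma enormN x : enorm (- x) = enorm x.
Proof. by rewrite -scaleN1r enormZ normrN1 mul1r. Qed.

Lemma bil1_le_enorm x y : `|bil 1%:M x y| <= enorm x * enorm y.
Proof.
rewrite -(ler_pXn2r (n := 2)) ?nnegrE ?mulr_ge0 ?enorm_ge0 //.
rewrite real_normK ?num_real // exprMn !sqr_enorm.
exact: bil_CauchySchwarz sym_posdef1.
Qed.

Lemma enormD x y : enorm (x + y) <= enorm x + enorm y.
Proof.
rewrite -(ler_pXn2r (n := 2)) ?nnegrE ?addr_ge0 ?enorm_ge0 //.
rewrite sqrrD !sqr_enorm bilDl !bilDr (bilC y) ?trmx1 //.
by have /ler_normlP[_] := bil1_le_enorm x y; lra.
Qed.

Lemma enormB x y : enorm (x - y) <= enorm x + enorm y.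
Proof. by rewrite -(enormN y) enormD. Qed.

Lemma enorm_subC x y : enorm (x - y) = enorm (y - x).
Proof. by rewrite -enormN opprB. Qed.

Lemma enorm_le_add x y : enorm x <= enorm y + enorm (x - y).
Proof. by rewrite -{1}(subrKC y x) enormD. Qed.

Lemma enorm_sum I (r : seq I) (P : pred I) (F : I -> 'cV[R]_n) :
  enorm (\sum_(i <- r | P i) F i) <= \sum_(i <- r | P i) enorm (F i).
Proof.
elim/big_ind2: _ => [|x1 x2 y1 y2 h1 h2|//]; first by rewrite enorm0.
exact: le_trans (enormD _ _) (lerD h1 h2).
Qed.

Lemma coord_le_enorm x i : `|x i 0| <= enorm x.
Proof.
rewrite -sqrtr_sqr ler_sqrt; last by apply: sumr_ge0 => j _; rewrite sqr_ge0.
by rewrite (bigD1 i) //= lerDl; apply: sumr_ge0 => j _; rewrite sqr_ge0.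
Qed.

Lemma enorm_le_sum x (u : 'I_n -> R) :
  (forall i, `|x i 0| <= u i) -> enorm x <= \sum_i u i.
Proof.
move=> xu; have u0 i : 0 <= u i by exact: le_trans (xu i).
rewrite -(ler_pXn2r (n := 2)) ?nnegrE ?enorm_ge0 ?sumr_ge0 //.
rewrite sqr_enorm bil1E [leRHS]expr2 mulr_suml ler_sum // => i _.
rewrite -expr2 -real_normK ?num_real // expr2 ler_pM //.
by apply: le_trans (xu i) _; rewrite (bigD1 i) //= lerDl sumr_ge0.
Qed.

(** The entrywise l1 norm, a crude upper bound for the operator norm. *)
Definition mxsum A : R := \sum_i \sum_j `|A i j|.

Lemma mxsum_ge0 A : 0 <= mxsum A.
Proof. by apply: sumr_ge0 => i _; apply: sumr_ge0. Qed.

Lemma bil_le_mxsum A x y : `|bil A x y| <= mxsum A * enorm x * enorm y.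
Proof.
rewrite bilE; apply: le_trans (ler_norm_sum _ _ _) _.
rewrite !mulr_suml ler_sum // => i _; apply: le_trans (ler_norm_sum _ _ _) _.
rewrite !mulr_suml ler_sum // => j _; rewrite !normrM (mulrC `|x i 0|).
by rewrite ler_pM ?mulr_ge0 ?ler_wpM2l ?coord_le_enorm.
Qed.

(** Write [|Ax|^2] as [bil A (A *m x) x], bound it by [bil_le_mxsum] and cancel one factor
    [|Ax|]. *)
Lemma enorm_mulmx A x : enorm (A *m x) <= mxsum A * enorm x.
Proof.
have := enorm_ge0 (A *m x); rewrite le_eqVlt => /predU1P[<-|Ax0].
  by rewrite mulr_ge0 ?mxsum_ge0 ?enorm_ge0.
rewrite -(ler_pM2r Ax0) -expr2 sqr_enorm -bil_mulmxr.
apply: le_trans (ler_norm _) (le_trans (bil_le_mxsum _ _ _) _).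
by rewrite mulrAC.
Qed.

Lemma qform_sub_le H x y : H^T = H ->
  `|qform H x - qform H y| <= mxsum H * enorm (x - y) * (enorm x + enorm y).
Proof.
move=> sH; have -> : qform H x - qform H y = bil H (x - y) (x + y).
  by rewrite !(bilDl, bilDr, bilNl) (bilC y x) // /qform -!/(bil _ _ _); ring.
apply: le_trans (bil_le_mxsum _ _ _) _.
by rewrite ler_wpM2l ?enormD // mulr_ge0 ?mxsum_ge0 ?enorm_ge0.
Qed.

(** A row [v] with [v H = 0] gives [v H v^T = 0], so definiteness forces [v = 0]. *)
Lemma posdef_unitmx H : sym_posdef H -> H \in unitmx.
Proof.
move=> [sH pH]; rewrite -row_free_unit -kermx_eq0; apply/eqP/row_matrixP => i.
rewrite row0; apply: trmx_inj; rewrite trmx0; apply/eqP; apply: contraT => /pH.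
by rewrite /qform trmxK -row_mul mulmx_ker row0 mul0mx mxE ltxx.
Qed.

(* Cauchy-Schwarz for the H-form on [x] and [H^-1 x] gives
   [|x|^4 <= |x|_H^2 (x^T H^-1 x)], which avoids eigenvalues. *)
Lemma posdef_coercive H : sym_posdef H ->
  exists2 lam : R, 0 < lam & forall x, lam * enorm x ^+ 2 <= qform H x.
Proof.
move=> pdH; have [sH _] := pdH; have uH := posdef_unitmx pdH.
exists (1 + mxsum (invmx H))^-1; first by rewrite invr_gt0 ltr_pwDl ?mxsum_ge0.
move=> x; rewrite ler_pdivrMl ?ltr_pwDl ?mxsum_ge0 //.
have := enorm_ge0 x; rewrite le_eqVlt => /predU1P[<-|x0].
  by rewrite expr0n mulr_ge0 ?addr_ge0 ?mxsum_ge0 ?qform_ge0.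
have := bil_CauchySchwarz x (invmx H *m x) pdH.
rewrite bil_mulmxr mulKVmx // -sqr_enorm.
have -> : qform H (invmx H *m x) = bil (invmx H) x x.
  rewrite /qform -/(bil _ _ _) bil_mulmxr mulKVmx // (bilC (_ *m _)) ?trmx1 //.
  by rewrite -bil_mulmxr.
have /ler_normlP[_ le] := bil_le_mxsum (invmx H) x x.
have x20 : 0 < enorm x ^+ 2 by rewrite exprn_gt0.
have := qform_ge0 x pdH; have := mxsum_ge0 (invmx H) => m0 q0 cs.
rewrite -(ler_pM2r x20) -expr2 (le_trans cs) //.
rewrite [leRHS]mulrAC [leRHS]mulrC ler_wpM2l //.
by rewrite (le_trans le) // -mulrA -expr2 ler_wpM2r ?sqr_ge0 // lerDr.
Qed.

(** In the expansion of the square, [h * mxsum H ^+ 2 <= lam] lets half of the gain [2 h |x|_H^2]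
    absorb the quadratic term. What remains is the factor [1 - h lam], which is at most
    [(1 - h lam / 2)^2]; [h lam <= 1] allows taking the root. *)
Lemma posdef_contraction H (lam h : R) x : sym_posdef H ->
  (forall x, lam * enorm x ^+ 2 <= qform H x) ->
  0 <= h -> h * mxsum H ^+ 2 <= lam -> h * lam <= 1 ->
  enorm (x - h *: (H *m x)) <= (1 - h * lam / 2) * enorm x.
Proof.
move=> [sH _] lamP h0 hL hlam1.
rewrite -(ler_pXn2r (n := 2)) ?nnegrE ?enorm_ge0 //; last first.
  by rewrite mulr_ge0 ?enorm_ge0 //; lra.
have -> : enorm (x - h *: (H *m x)) ^+ 2 =
    enorm x ^+ 2 - 2 * (h * qform H x) + h ^+ 2 * enorm (H *m x) ^+ 2.
  rewrite !sqr_enorm bilDl !bilDr !bilNl !bilNr !bilZl !bilZr.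
  by rewrite (bilC (_ *m _)) ?trmx1 // -bil_mulmxr /qform -/(bil _ _ _); ring.
have Hx : enorm (H *m x) ^+ 2 <= mxsum H ^+ 2 * enorm x ^+ 2.
  rewrite -exprMn lerXn2r ?nnegrE ?mulr_ge0 ?mxsum_ge0 ?enorm_ge0 //.
  exact: enorm_mulmx.
have hHx : h ^+ 2 * enorm (H *m x) ^+ 2 <= h * lam * enorm x ^+ 2.
  apply: le_trans (ler_wpM2l (sqr_ge0 _) Hx) _.
  rewrite mulrA expr2 -(mulrA h h).
  by rewrite ler_wpM2r ?sqr_ge0 // ler_wpM2l.
have := ler_wpM2l h0 (lamP x); have := sqr_ge0 (h * lam / 2 * enorm x).
nra.
Qed.

End bilinear.

(** * Sums of trigonometric functions over a full period *)

Section periodic_sums.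
Variable R : realType.

Lemma sin_lipschitz (x y : R) : `|sin x - sin y| <= `|x - y|.
Proof.
wlog xy : x y / y <= x => [hw|].
  have [/hw//|/ltW/hw] := leP y x.
  by rewrite -normrN opprB -(normrN (x - y)) opprB.
have [|c _ ->] := @MVT_segment R sin cos y x xy (fun z _ => is_derive_sin z).
  exact/continuous_subspaceT/continuous_sin.
by rewrite normrM ler_piMl ?cos_max.
Qed.

Lemma sum_shift_periodic (V : zmodType) (f : nat -> V) (T t : nat) :
  (forall j, f (j + T)%N = f j) ->
  \sum_(t <= j < t + T) f j = \sum_(0 <= j < T) f j.
Proof.
move=> fT; elim: t => [//|t IH]; rewrite -{}IH.
have [->|T0] := posnP T; first by rewrite !addn0 !big_geq.
rewrite addSn big_nat_recr /=; last by rewrite -addn1 leq_add2l.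
by rewrite fT addrC -big_ltn // -addn1 leq_add2l.
Qed.

(** Twice the sum pairs [f (j + 1)] with [f (T - (j + 1))], and each pair cancels. Doubling avoids
    treating the fixed points of the reflection separately. *)
Lemma sum_odd_periodic (f : R -> R) (T t : nat) :
  (forall x, f (- x) = - f x) -> (forall x, f (x + T%:R) = f x) ->
  \sum_(t <= j < t + T) f j%:R = 0.
Proof.
move=> fN fT.
have fTn (j : nat) : f (j + T)%:R = f j%:R by rewrite natrD fT.
rewrite (@sum_shift_periodic _ (fun j => f j%:R)) //.
apply: (@mulrI _ 2); rewrite ?unitfE ?pnatr_eq0 // mulr0 mulrDl mul1r.
rewrite -{1}(@sum_shift_periodic _ (fun j => f j%:R) T 1) // add1n.
rewrite big_add1 /= [X in _ + X]big_nat_rev /= -big_split /= big_nat big1 //.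
move=> j /andP[_ jT]; rewrite add0n natrB // addrC.
have -> : T%:R - j.+1%:R = - j.+1%:R + T%:R :> R by rewrite addrC.
by rewrite fT fN addNr.
Qed.

(** The Dirichlet kernel trick: the factor [2 sin (w / 2)] turns each cosine into a difference of
    sines at consecutive half-integer multiples of [w]. *)
Lemma sum_cos_telescope (w : R) (T : nat) :
  2 * sin (w / 2) * \sum_(0 <= j < T) cos (w * j%:R) =
  sin (w * T%:R - w / 2) + sin (w / 2).
Proof.
have e (j : nat) : 2 * sin (w / 2) * cos (w * j%:R) =
    sin (w * j.+1%:R - w / 2) - sin (w * j%:R - w / 2).
  have -> : w * j.+1%:R - w / 2 = w * j%:R + w / 2 by rewrite -natr1; field.
  by rewrite sinD sinB; ring.
rewrite mulr_sumr (eq_bigr _ (fun j _ => e j)) telescope_sumr //.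
by rewrite mulr0 sub0r sinN opprK.
Qed.

(** With [w T = 2 pi m] the telescoped side vanishes, while [sin (w / 2) = sin (pi m / T)] is
    nonzero because [0 < m < T]. *)
Lemma sum_cos_period (T m : nat) : (0 < m < T)%N ->
  \sum_(0 <= j < T) cos (2 * pi * m%:R / T%:R * j%:R) = 0 :> R.
Proof.
move=> /andP[m0 mT]; have T0 : (T%:R != 0 :> R).
  by rewrite pnatr_eq0 -lt0n (leq_ltn_trans _ mT).
set w := 2 * pi * m%:R / T%:R.
have wT : w * T%:R = 0 + (pi *+ 2) *+ m.
  by rewrite add0r divfK // -[RHS]mulr_natr -(mulr_natl pi).
have := sum_cos_telescope w T; rewrite wT addrAC (periodicn (@sinD2pi R)).
rewrite sub0r sinN addNr => /eqP; rewrite mulf_eq0 => /orP[|/eqP//].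
rewrite mulf_eq0 pnatr_eq0 /= gt_eqF // sin_gt0_pi //.
have -> : w / 2 = pi * (m%:R / T%:R) by rewrite /w; field.
rewrite pmulr_rgt0 ?pi_gt0 // divr_gt0 ?ltr0n ?(leq_ltn_trans _ mT) //=.
rewrite gtr_pMr ?pi_gt0 // ltr_pdivrMr ?ltr0n ?(leq_ltn_trans _ mT) //.
by rewrite mul1r ltr_nat.
Qed.

(** Product-to-sum leaves the frequencies [p - q] and [p + q]. The bound [p + q < T] keeps the
    latter from aliasing to zero, so only [p = q] contributes. *)
Lemma sum_sin_mul_period (T p q : nat) :
  (0 < p)%N -> (0 < q)%N -> (p + q < T)%N ->
  \sum_(0 <= j < T) sin (2 * pi * p%:R / T%:R * j%:R) *
                    sin (2 * pi * q%:R / T%:R * j%:R) =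
  (p == q)%:R * (T%:R / 2) :> R.
Proof.
wlog pq : p q / (q <= p)%N => [hw|] p0 q0 pqT.
  have [/hw|/ltnW qp] := leqP q p; first exact.
  rewrite eq_sym -hw // 1?addnC //.
  by apply: eq_bigr => j _; rewrite mulrC.
have e (j : nat) : sin (2 * pi * p%:R / T%:R * j%:R) *
      sin (2 * pi * q%:R / T%:R * j%:R) =
    (cos (2 * pi * (p - q)%:R / T%:R * j%:R) -
    cos (2 * pi * (p + q)%:R / T%:R * j%:R)) / 2 :> R.
  pose c : R := 2 * pi / T%:R * j%:R.
  have cE (x : R) : 2 * pi * x / T%:R * j%:R = c * x by rewrite /c; ring.
  rewrite !cE natrB // natrD mulrBr mulrDr cosB cosD.
  by field.
rewrite (eq_bigr _ (fun j _ => e j)) -mulr_suml sumrB.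
rewrite [X in _ - X]sum_cos_period; last first.
  by rewrite addn_gt0 p0.
rewrite subr0; have [->|npq] := eqVneq p q.
  rewrite subnn mulr0 mul0r mul1r; congr (_ / 2).
  under eq_bigr do rewrite mul0r cos0.
  by rewrite big_const_nat subn0 iter_addr_0.
rewrite sum_cos_period ?mul0r // subn_gt0 ltn_neqAle eq_sym npq pq /=.
by rewrite (leq_ltn_trans _ pqT) // (leq_trans (leq_subr _ _)) ?leq_addr.
Qed.

End periodic_sums.

(** * Size, slowness and averaging of the dithers *)

Section dither.
Variables (R : realType) (n DM : nat) (a : 'I_n -> R).
Hypotheses (n_gt0 : (0 < n)%N) (DM_gt0 : (0 < DM)%N).
Hypothesis a_gt0 : forall i, 0 < a i.
Implicit Types (eps : R) (i : 'I_n) (j t : nat).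

Local Notation T eps := `|dither_period n DM eps|%N.

Lemma dither_periodE eps : dither_period n DM eps = T eps.
Proof. by rewrite gez0_abs // /dither_period le_max orbC. Qed.

Lemma dither_period_ge eps : (2 * n + 1 <= T eps)%N.
Proof. by rewrite -lez_nat -dither_periodE /dither_period le_max lexx orbT. Qed.

Lemma dither_period_gt0 eps : (0 < T eps)%N.
Proof. by apply: leq_trans (dither_period_ge eps); rewrite addn1. Qed.

(** Each arm of the maximum is at most its summand over [sqrt eps]: the floor lies below
    [1 / sqrt eps], and [1 <= 1 / sqrt eps]. *)
Lemma dither_period_le eps : 0 < eps -> Num.sqrt eps <= 1 ->
  (T eps)%:R * Num.sqrt eps <= (n * DM + (2 * n + 1))%:R.
Proof.
move=> eps0 s1; have s0 : 0 < Num.sqrt eps by rewrite sqrtr_gt0.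
rewrite -ler_pdivlMr //.
rewrite [leLHS](_ : _ = (dither_period n DM eps)%:~R); last first.
  by rewrite {2}dither_periodE.
have inv_ge1 : 1 <= (Num.sqrt eps)^-1 by rewrite invf_ge1.
rewrite /dither_period; set p := (2 * n + 1)%N; rewrite maxEle; case: ifP => _.
  rewrite -pmulrn natrD mulrDl ler_wpDl ?mulr_ge0 ?invr_ge0 ?(ltW s0) //.
  by rewrite ler_peMr.
rewrite intrM -pmulrn natrD mulrDl.
rewrite ler_wpDr ?mulr_ge0 ?invr_ge0 ?(ltW s0) //.
by rewrite ler_wpM2l // -[leRHS]mul1r floor_le.
Qed.

(** For [x = 1 / sqrt eps >= 1] the floor is at least 1, so
    [x < floor x + 1 <= 2 floor x <= 2 T]. *)
Lemma dither_period_lower eps : 0 < eps -> Num.sqrt eps <= 1 ->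
  1 <= 2 * Num.sqrt eps * (T eps)%:R.
Proof.
move=> eps0 s1; have s0 : 0 < Num.sqrt eps by rewrite sqrtr_gt0.
have inv_ge1 : 1 <= 1 / Num.sqrt eps by rewrite div1r invf_ge1.
rewrite mulrAC -ler_pdivrMr //.
have fl := floorD1_gt (1 / Num.sqrt eps); rewrite intrD in fl.
have f1 : 1 <= (Num.floor (1 / Num.sqrt eps))%:~R :> R.
  by rewrite ler1z -gtz0_ge1 floor_gt0.
have fT : (Num.floor (1 / Num.sqrt eps))%:~R <= (T eps)%:R :> R.
  rewrite [leRHS](_ : _ = (dither_period n DM eps)%:~R); last first.
    by rewrite {2}dither_periodE.
  rewrite ler_int /dither_period le_max ler_peMl //.
    by rewrite -(ler0z R) (le_trans _ f1).
  by rewrite lez_nat muln_gt0 n_gt0.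
by move: (_%:~R) fl f1 fT => f; lra.
Qed.

Lemma omegaE eps i : omega DM i eps = 2 * pi * i.+1%:R / (T eps)%:R.
Proof. by rewrite /omega {1}dither_periodE. Qed.

Lemma omega_ge0 eps i : 0 <= omega DM i eps.
Proof. by rewrite omegaE divr_ge0 // !mulr_ge0 ?pi_ge0. Qed.

Lemma omega_le eps i : 0 < eps -> Num.sqrt eps <= 1 ->
  omega DM i eps <= 4 * pi * n%:R * Num.sqrt eps.
Proof.
move=> eps0 s1; rewrite omegaE ler_pdivrMr ?ltr0n ?dither_period_gt0 //.
have -> : 4 * pi * n%:R * Num.sqrt eps * (T eps)%:R =
  2 * pi * n%:R * (2 * Num.sqrt eps * (T eps)%:R) by ring.
rewrite -[leLHS]mulr1 ler_pM ?mulr_ge0 ?pi_ge0 ?dither_period_lower //.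
by rewrite ler_wpM2l ?mulr_ge0 ?pi_ge0 // ler_nat.
Qed.

Lemma omega_bigO i : (omega DM i : R -> R^o) =O_ (0^'+) (Num.sqrt : R -> R^o).
Proof.
apply/eqO_exP; exists (4 * pi * n%:R).
  by rewrite !mulr_gt0 ?pi_gt0 ?ltr0n.
near=> eps; have eps0 : 0 < eps by near: eps; exact: nbhs_right_gt.
rewrite ger0_norm ?omega_ge0 // ger0_norm ?sqrtr_ge0 // omega_le //.
rewrite -[leRHS]sqrtr1 ler_sqrt //.
by near: eps; exact: nbhs_right_le.
Unshelve. all: by end_near. Qed.

Lemma enorm_S_dither eps j : enorm (S_dither DM a eps j) <= \sum_i a i.
Proof.
apply: enorm_le_sum => i; rewrite mxE normrM (gtr0_norm (a_gt0 i)).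
by rewrite ler_piMr ?sin_max // ltW.
Qed.

Lemma enorm_M_dither eps j : enorm (M_dither DM a eps j) <= \sum_i 2 / a i.
Proof.
have a2 i : 0 <= 2 / a i by rewrite divr_ge0 // ltW.
apply: enorm_le_sum => i; rewrite mxE normrM (ger0_norm (a2 i)).
by rewrite ler_piMr ?sin_max.
Qed.

Lemma enorm_S_dither_delay eps j d : 0 < eps -> Num.sqrt eps <= 1 ->
  (d <= DM)%N -> (d <= j)%N ->
  enorm (S_dither DM a eps (j - d) - S_dither DM a eps j) <=
  (\sum_i a i) * (4 * pi * n%:R * DM%:R) * Num.sqrt eps.
Proof.
move=> eps0 s1 dDM dj; rewrite -mulrA mulr_suml; apply: enorm_le_sum => i.
rewrite !mxE -mulrBr normrM (gtr0_norm (a_gt0 i)) ler_wpM2l ?(ltW (a_gt0 i)) //.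
apply: le_trans (sin_lipschitz _ _) _.
rewrite -mulrBr normrM (ger0_norm (omega_ge0 _ _)) natrB //.
rewrite addrAC subrr sub0r normrN normr_nat [leRHS]mulrAC.
by rewrite ler_pM ?omega_ge0 ?omega_le ?ler_nat.
Qed.

(* The even-order terms of the output are odd and periodic once multiplied by
   [M j], so only the linear term survives averaging. *)
Lemma dither_average (H : 'M[R]_n) (Qstar : R) (x : 'cV[R]_n) eps t :
  H^T = H ->
  \sum_(t <= j < t + T eps)
    (Qstar + 1 / 2 * qform H (x + S_dither DM a eps j)) *: M_dither DM a eps j =
  (T eps)%:R *: (H *m x).
Proof.
move=> sH; apply/matrixP => i l; rewrite ord1 {l} summxE [RHS]mxE.
(* Time becomes real, so that oddness, which involves negative times, can be stated. *)
pose S (u : R) : 'cV[R]_n := \col_l (a l * sin (omega DM l eps * u)).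
pose f u : R := (Qstar + 1 / 2 * (qform H x + qform H (S u))) *
  (2 / a i * sin (omega DM i eps * u)).
have SN u : S (- u) = - S u.
  by apply/matrixP => l m; rewrite !mxE mulrN sinN mulrN.
have sinT (l : 'I_n) u : sin (omega DM l eps * (u + (T eps)%:R)) =
    sin (omega DM l eps * u).
  rewrite (mulrDr (omega DM l eps)) [X in _ + X](_ : _ = (pi *+ 2) *+ l.+1).
    exact: periodicn (@sinD2pi R) _ _.
  rewrite omegaE divfK ?pnatr_eq0 -?lt0n ?dither_period_gt0 //.
  by rewrite -[RHS]mulr_natr -(mulr_natl pi).
have ST u : S (u + (T eps)%:R) = S u.
  by apply/matrixP => l m; rewrite !mxE sinT.
have f0 : \sum_(t <= j < t + T eps) f j%:R = 0.
  apply: sum_odd_periodic => u; first by rewrite /f SN qformN mulrN sinN !mulrN.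
  by rewrite /f ST sinT.
rewrite -[LHS]subr0 -[X in _ - X]f0 -sumrB.
pose g (l : 'I_n) j : R :=
  sin (omega DM l eps * j%:R) * sin (omega DM i eps * j%:R).
have e j : ((Qstar + 1 / 2 * qform H (x + S_dither DM a eps j)) *:
    M_dither DM a eps j) i 0 - f j%:R =
    \sum_l (H *m x) l 0 * a l * (2 / a i) * g l j.
  rewrite qformD // (bilC x) // bil_mulmxr bil1E !mxE /f -/(S j%:R).
  set b := \sum_l _.
  rewrite [LHS](_ : _ = b * (2 / a i * sin (omega DM i eps * j%:R))).
    by rewrite mulr_suml; apply: eq_bigr => l _; rewrite mxE /g; ring.
  by field; rewrite gt_eqF.
rewrite (eq_bigr _ (fun j _ => e j)) exchange_big /=.
have gsum l : \sum_(t <= j < t + T eps) g l j = (l == i)%:R * ((T eps)%:R / 2).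
  rewrite (@sum_shift_periodic _ (g l)); last first.
    by move=> j; rewrite /g natrD !sinT.
  rewrite /g !omegaE sum_sin_mul_period //.
  (* The two frequency indices add up to at most [2 n], below the minimal period [2 n + 1]. *)
  rewrite (leq_trans _ (dither_period_ge eps)) // addn1 ltnS mul2n -addnn.
  by rewrite leq_add.
rewrite (bigD1 i) //= [X in _ + X]big1 ?addr0 => [|l li]; last first.
  by rewrite -mulr_sumr gsum (negbTE li) mul0r mulr0.
rewrite -mulr_sumr gsum eqxx mul1r.
(* The amplitudes are normalized for this: [a i * (2 / a i) * (T / 2) = T]. *)
by field; rewrite gt_eqF.
Qed.

End dither.

(** * Displacement along a sequence and distance to a ball *)

Section recursion.
Variables (R : realType) (n : nat).
Implicit Types (x : 'cV[R]_n) (th : nat -> 'cV[R]_n).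

Lemma enorm_chain th (d : R) (s t : nat) : (s <= t)%N ->
  (forall j, (s <= j < t)%N -> enorm (th j.+1 - th j) <= d) ->
  enorm (th t - th s) <= (t - s)%:R * d.
Proof.
move=> st hd; rewrite -telescope_sumr //; apply: le_trans (enorm_sum _ _ _) _.
have -> : (t - s)%:R * d = \sum_(s <= j < t) d.
  by rewrite sumr_const_nat mulr_natl.
by rewrite big_nat [leRHS]big_nat ler_sum.
Qed.

(** Serves to convert the contraction factor of a whole period into a rate per step. *)
Lemma bernoulli_ineq (u : R) m : 0 <= u <= 1 -> 1 - m%:R * u <= (1 - u) ^+ m.
Proof.
move=> /andP[u0 u1]; elim: m => [|m IH]; first by rewrite mul0r subr0 expr0.
have m0 : 0 <= m%:R :> R by [].
have u1' : 0 <= 1 - u by rewrite subr_ge0.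
rewrite exprS; apply: le_trans _ (ler_wpM2l u1' IH).
have := mulr_ge0 m0 (mulr_ge0 u0 u0); rewrite -natr1; nra.
Qed.

Lemma edist_eball_le x (p q rho : R) :
  0 <= q -> q < rho -> 0 <= p -> enorm x <= p + q ->
  edist_set x (@eball R n rho) <= p.
Proof.
move=> q0 qrho p0 xpq.
suff [y yq xyp] : exists2 y, enorm y <= q & enorm (x - y) <= p.
  apply: le_trans xyp; apply: ge_inf.
  2: by exists y => //; exact: le_lt_trans qrho.
  by exists 0 => _ [z _ <-]; exact: enorm_ge0.
have [xq|qx] := leP (enorm x) q; first by exists x; rewrite // subrr enorm0.
have x0 : 0 < enorm x by exact: le_lt_trans qx.
(* Outside the closed ball of radius [q], project radially onto its sphere; [q < rho] puts this
   point in the open ball. *)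
exists ((q / enorm x) *: x).
  by rewrite enormZ ger0_norm ?divfK ?gt_eqF // divr_ge0 // ltW.
rewrite -{1}(scale1r x) -scalerBl enormZ ger0_norm; last first.
  by rewrite subr_ge0 ler_pdivrMr // mul1r ltW.
by rewrite mulrBl divfK ?gt_eqF // mul1r lerBlDr.
Qed.

End recursion.

(** * Averaging over one period and the resulting decay *)

Section averaging.
Variables (R : realType) (n : nat) (H : 'M[R]_n) (Qstar sigma0 : R) (DM : nat).
Variables (a : 'I_n -> R) (k lam eps : R).
Hypotheses (n_gt0 : (0 < n)%N) (DM_gt0 : (0 < DM)%N).
Hypothesis a_gt0 : forall i, 0 < a i.
Hypotheses (k_gt0 : 0 < k) (lam_gt0 : 0 < lam) (eps_gt0 : 0 < eps).
Hypothesis pdH : sym_posdef H.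
Hypothesis lamP : forall x, lam * enorm x ^+ 2 <= qform H x.

Local Notation T := `|dither_period n DM eps|%N.
Local Notation S := (S_dither DM a eps).
Local Notation M := (M_dither DM a eps).
Local Notation L := (mxsum H).
Local Notation s := (Num.sqrt eps).

Local Notation sigma := (sigma0 + 1).
Local Notation sumS := (\sum_i a i).
Local Notation sumM := (\sum_i 2 / a i).
Local Notation dS := (sumS * (4 * pi * n%:R * DM%:R)).

(** This constant and the rates built on it are free of [eps], so the threshold on [eps] can later
    be computed from them. It bounds the output as long as the iterates stay within [sigma]. *)
Definition output_bound : R := `|Qstar| + 1 / 2 * (L * (sigma + sumS) ^+ 2).

Definition step_rate : R := k * output_bound * sumM.

Definition period_rate : R := (n * DM + (2 * n + 1))%:R.

Local Notation K := step_rate.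
Local Notation c := period_rate.

(** Coefficient of [sqrt eps] in the cost of freezing: [(c + DM) K] is the drift of the iterate over
    a period plus a delay, [dS] the drift of the dither. *)
Definition output_error_rate : R :=
  L * ((c + DM%:R) * K + dS) * (sigma + sumS).

Local Notation E := output_error_rate.

(** Chosen so that the freezing error of one period, [eps k T sumM E s], equals [(1 - rho) (B s)];
    thus [B s] is the fixed point of the sampled recursion. *)
Definition residual_rate : R := 2 * sumM * E / lam.

Local Notation B := residual_rate.

Definition attraction_rate : R := B + c * K.
Let h := eps * k * T%:R.
Let rho := 1 - h * lam / 2.

Let y x j := Qstar + 1 / 2 * qform H (x + S j).

Hypothesis sigma0_gt0 : 0 < sigma0.
Hypothesis s_le1 : s <= 1.

Let epsE : eps = s * s.
Proof. by rewrite -expr2 sqr_sqrtr // ltW. Qed.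

Let s_gt0 : 0 < s. Proof. by rewrite sqrtr_gt0. Qed.

Let sumS_ge0 : 0 <= sumS.
Proof. by apply: sumr_ge0 => i _; exact: ltW. Qed.

Let sumM_ge0 : 0 <= sumM.
Proof. by apply: sumr_ge0 => i _; rewrite divr_ge0 // ltW. Qed.

Let sigma_ge0 : 0 <= sigma.
Proof. by rewrite addr_ge0 // ltW. Qed.

Let output_bound_ge0 : 0 <= output_bound.
Proof.
by rewrite addr_ge0 // mulr_ge0 // mulr_ge0 ?mxsum_ge0 // sqr_ge0.
Qed.

Let K_ge0 : 0 <= K.
Proof. by rewrite !mulr_ge0 // ltW. Qed.

Let Ks_ge0 : 0 <= K * s.
Proof. by rewrite mulr_ge0 // ltW. Qed.

Let dS_ge0 : 0 <= dS.
Proof. by rewrite !mulr_ge0 ?pi_ge0. Qed.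

Let c_ge0 : 0 <= c. Proof. exact: ler0n. Qed.

Let E_ge0 : 0 <= E.
Proof.
apply: mulr_ge0; last exact: addr_ge0.
apply: mulr_ge0; first exact: mxsum_ge0.
by apply: addr_ge0 => //; apply: mulr_ge0 => //; exact: addr_ge0.
Qed.

Let B_ge0 : 0 <= B.
Proof.
apply: divr_ge0; last exact: ltW.
by apply: mulr_ge0 => //; exact: mulr_ge0.
Qed.

Lemma attraction_rate_ge0 : 0 <= attraction_rate.
Proof. by rewrite addr_ge0 // mulr_ge0. Qed.

Let T_gt0 : 0 < T%:R :> R.
Proof. by rewrite ltr0n dither_period_gt0. Qed.

Let Ts_le : T%:R * s <= c.
Proof. exact: dither_period_le. Qed.

Let h_gt0 : 0 < h.
Proof. by rewrite !mulr_gt0. Qed.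

Let h_le : h <= s * (k * c).
Proof.
rewrite /h {1}epsE; have -> : s * s * k * T%:R = s * (k * (T%:R * s)) by ring.
by rewrite !ler_wpM2l // ltW.
Qed.

Let output_le x j : enorm x <= sigma -> `|y x j| <= output_bound.
Proof.
move=> xs; apply: le_trans (ler_normD _ _) _.
rewrite lerD2l normrM ger0_norm //.
rewrite ler_wpM2l //; apply: le_trans (bil_le_mxsum _ _ _) _.
have xS : enorm (x + S j) <= sigma + sumS.
  by apply: le_trans (enormD _ _) (lerD xs _); exact: enorm_S_dither.
by rewrite -mulrA ler_wpM2l ?mxsum_ge0 // expr2 ler_pM ?enorm_ge0.
Qed.

Let output_sub_le x x' j d : (d <= DM)%N -> (d <= j)%N ->
  enorm x <= sigma -> enorm x' <= sigma ->
  enorm (x' - x) <= (c + DM%:R) * K * s -> `|y x' (j - d) - y x j| <= E * s.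
Proof.
move=> dDM dj xs x's x'x; rewrite /y opprD addrACA subrr add0r -mulrBr.
rewrite normrM ger0_norm //; set S' := S (j - d).
have Sj : enorm (S j) <= sumS by exact: enorm_S_dither.
have S'j : enorm S' <= sumS by exact: enorm_S_dither.
have u : enorm (x' + S' - (x + S j)) <= ((c + DM%:R) * K + dS) * s.
  rewrite opprD addrACA mulrDl; apply: le_trans (enormD _ _) (lerD x'x _).
  exact: enorm_S_dither_delay.
have v : enorm (x' + S') + enorm (x + S j) <= 2 * (sigma + sumS).
  have := enormD x' S'; have := enormD x (S j); lra.
have := qform_sub_le (x' + S') (x + S j) pdH.1 => q.
have -> : E * s =
    1 / 2 * (L * (((c + DM%:R) * K + dS) * s) * (2 * (sigma + sumS))).
  by rewrite /output_error_rate; field.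
rewrite ler_wpM2l //; apply: le_trans q _.
rewrite ler_pM ?addr_ge0 ?mulr_ge0 ?mxsum_ge0 ?enorm_ge0 //.
by rewrite ler_wpM2l ?mxsum_ge0.
Qed.

(** Since [h <= s k c], the first two conditions make [posdef_contraction] applicable; the third
    leaves room for [B s + c K s] inside the margin 1 between [sigma0] and [sigma]. *)
Hypothesis sL : s * (k * c) * L ^+ 2 <= lam.
Hypothesis slam : s * (k * c) * lam <= 1.
Hypothesis small : s * attraction_rate < 1.

Let hL : h * L ^+ 2 <= lam.
Proof. by apply: le_trans sL; rewrite ler_wpM2r ?sqr_ge0. Qed.

Let hlam : h * lam <= 1.
Proof. by apply: le_trans slam; rewrite ler_wpM2r // ltW. Qed.

Let rho_ge0 : 0 <= rho.
Proof. by rewrite subr_ge0 ler_pdivrMr // mul1r (le_trans hlam) // ler1n. Qed.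

Let rho_le1 : rho <= 1.
Proof. by rewrite gerBl divr_ge0 // mulr_ge0 // ltW. Qed.

(** The rate per step: [rho = 1 - T (1 - r)], hence [rho <= r ^+ T] by Bernoulli. *)
Let r := 1 - eps * k * lam / 2.

Lemma decay_rate_itv : 0 < r < 1.
Proof.
have u0 : 0 < eps * k * lam by rewrite !mulr_gt0.
have u1 : eps * k * lam <= 1.
  apply: le_trans hlam; rewrite /h [leRHS]mulrAC ler_peMr ?(ltW u0) //.
  by rewrite ler1n dither_period_gt0.
by rewrite /r; apply/andP; split; lra.
Qed.

Section solution.
Variables (D : nat -> nat) (th : nat -> 'cV[R]_n).
Hypothesis D_le : forall j, (D j <= DM)%N.
Hypothesis thP : es_solution H Qstar sigma0 DM a k eps D th.

Let th_step j : (DM <= j)%N ->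
  th j.+1 = th j - (eps * k * y (th (j - D j)%N) (j - D j)%N) *: M j.
Proof. by case: thP => _ _; exact. Qed.

Let step_le j : (forall i, (i <= j)%N -> enorm (th i) <= sigma) ->
  enorm (th j.+1 - th j) <= eps * K.
Proof.
move=> bd; have [jDM|DMj] := ltnP j DM.
  case: thP => th0 _ _; rewrite (th0 j.+1) // (th0 j (ltnW jDM)) subrr enorm0.
  by rewrite mulr_ge0 // ltW.
rewrite th_step // addrAC subrr sub0r enormN enormZ normrM.
rewrite gtr0_norm ?mulr_gt0 // /step_rate.
rewrite -/output_bound !mulrA.
rewrite ler_pM ?enorm_ge0 ?enorm_M_dither //.
  by rewrite !mulr_ge0 // ltW.
rewrite ler_wpM2l ?mulr_ge0 ?(ltW eps_gt0) ?(ltW k_gt0) //.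
by rewrite output_le // bd // leq_subr.
Qed.

Let dist_le i j : (i <= j)%N ->
  (forall l, (l < j)%N -> enorm (th l) <= sigma) ->
  enorm (th j - th i) <= (j - i)%:R * (eps * K).
Proof.
move=> ij bd; apply: enorm_chain => // l /andP[_ lj].
by apply: step_le => m ml; rewrite bd // (leq_ltn_trans ml).
Qed.

(** The increments split into outputs frozen at [th t], which [dither_average] sums to exactly
    [- h H th t], and errors [e j] of size [E s]. *)
Let period_contraction t : (DM <= t)%N ->
  (forall i, (i < t + T)%N -> enorm (th i) <= sigma) ->
  enorm (th (t + T)%N) <= rho * enorm (th t) + (1 - rho) * (B * s).
Proof.
move=> DMt bd.
have tT : (t < t + T)%N by rewrite -addn1 leq_add2l dither_period_gt0.
pose e j := y (th (j - D j)%N) (j - D j)%N - y (th t) j.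
have ee j : (t <= j < t + T)%N -> `|e j| <= E * s.
  move=> /andP[tj jT].
  have Dj : (D j <= j)%N by rewrite (leq_trans (D_le j)) ?(leq_trans DMt).
  have dj : (j - D j < t + T)%N by rewrite (leq_ltn_trans (leq_subr _ _)).
  apply: output_sub_le => //; [exact: bd|exact: bd|].
  (* Here [eps = s * s] is split between [m s] and [K s]; then [T s <= c], and [DM s <= DM] because
     [s <= 1]. *)
  have dK m : (m <= DM + T)%N -> m%:R * (eps * K) <= (c + DM%:R) * K * s.
    move=> mT; have -> : m%:R * (eps * K) = m%:R * s * (K * s).
      by rewrite {1}epsE; ring.
    rewrite -[leRHS]mulrA ler_wpM2r //.
    have mR : m%:R <= DM%:R + T%:R :> R by rewrite -natrD ler_nat.
    apply: le_trans (ler_wpM2r (ltW s_gt0) mR) _.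
    by rewrite mulrDl addrC lerD // ler_piMr.
  (* The delayed time is either inside the period, less than [T] after [t], or at most [DM] before
     [t]. *)
  have [le|/ltnW le] := leqP t (j - D j).
    apply: le_trans (dist_le le _) (dK _ _) => [l lj|].
      by apply: bd; exact: ltn_trans dj.
    by rewrite leq_subLR addnCA (leq_trans (ltnW dj)) // leq_addl.
  rewrite enorm_subC; apply: le_trans (dist_le le _) (dK _ _) => [l lj|].
    by apply: bd; exact: ltn_trans tT.
  rewrite leq_subLR (leq_trans tj) // -{1}(subnK Dj) leq_add2l.
  by rewrite (leq_trans (D_le j)) ?leq_addr.
have thT : th (t + T)%N = th t - h *: (H *m th t) -
    (eps * k) *: \sum_(t <= j < t + T) e j *: M j.
  rewrite -[LHS](subrK (th t)) addrC -addrA; congr (_ + _).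
  rewrite -telescope_sumr ?leq_addr // /h -[(_ * T%:R) *: _]scalerA.
  rewrite -(dither_average DM a_gt0 Qstar (th t) eps t pdH.1) //.
  rewrite -opprD -scalerDr -big_split /= scaler_sumr -sumrN.
  rewrite [LHS]big_nat [RHS]big_nat; apply: eq_bigr => j /andP[tj _].
  rewrite th_step ?(leq_trans DMt) // addrAC subrr sub0r -scalerDl scalerA.
  by rewrite [_ + e j]addrC subrK.
rewrite {}thT; apply: le_trans (enormB _ _) _; apply: lerD.
  by apply: posdef_contraction => //; exact: ltW.
rewrite enormZ gtr0_norm ?mulr_gt0 //.
have -> : (1 - rho) * (B * s) = eps * k * (T%:R * (E * s * sumM)).
  by rewrite /rho /residual_rate /h; field; rewrite gt_eqF.
rewrite ler_wpM2l ?mulr_ge0 ?(ltW eps_gt0) ?(ltW k_gt0) //.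
apply: le_trans (enorm_sum _ _ _) _.
have -> : T%:R * (E * s * sumM) = \sum_(t <= j < t + T) E * s * sumM.
  by rewrite sumr_const_nat addnC addnK mulr_natl.
rewrite big_nat [leRHS]big_nat ler_sum // => j jt.
by rewrite enormZ ler_pM ?enorm_ge0 ?ee ?enorm_M_dither.
Qed.

(** A bootstrap: bounds up to [t + l] limit the displacement at [t + l + 1] to [c K s], and [small]
    then keeps that iterate below [sigma]. *)
Let window_le t : (DM <= t)%N ->
  (forall i, (i <= t)%N -> enorm (th i) < sigma) ->
  enorm (th t) <= sigma0 + B * s ->
  forall l, (l <= T)%N ->
    (forall i, (i <= t + l)%N -> enorm (th i) < sigma) /\
    enorm (th (t + l)%N - th t) <= c * K * s.
Proof.
move=> DMt bd tB.
have dl l : (l <= T)%N -> l%:R * (eps * K) <= c * K * s.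
  move=> lT; have -> : l%:R * (eps * K) = l%:R * s * (K * s).
    by rewrite {1}epsE; ring.
  rewrite -[leRHS]mulrA ler_wpM2r //.
  by apply: le_trans Ts_le; rewrite ler_wpM2r ?ler_nat // ltW.
elim=> [_|l IH lT].
  by rewrite addn0 subrr enorm0 !mulr_ge0 // ltW.
have [bdl _] := IH (ltnW lT).
have near_t : enorm (th (t + l.+1)%N - th t) <= c * K * s.
  apply: le_trans (dist_le (leq_addr _ _) _) _ => [i|].
    by rewrite addnS ltnS => /bdl/ltW.
  by rewrite addKn dl.
split=> // i; rewrite addnS leq_eqVlt => /predU1P[->|]; last exact: bdl.
rewrite -addnS; apply: le_lt_trans (enorm_le_add _ (th t)) _.
apply: le_lt_trans (lerD tB near_t) _.
by rewrite -addrA ltrD2l -mulrDl mulrC.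
Qed.

(** Both claims need a joint induction: contraction assumes boundedness over the period, and
    boundedness over the next period starts from the contracted sample. *)
Let period_invariant m :
  (forall i, (i <= DM + m * T)%N -> enorm (th i) < sigma) /\
  enorm (th (DM + m * T)%N) <= rho ^+ m * sigma0 + B * s.
Proof.
have Bs0 : 0 <= B * s by rewrite mulr_ge0 // ltW.
elim: m => [|m [bd IH]].
  case: thP => _ th0 _; rewrite addn0 expr0; split=> [i /th0|].
    by have : sigma0 < sigma; lra.
  by have := th0 DM (leqnn _); lra.
have tB : enorm (th (DM + m * T)%N) <= sigma0 + B * s.
  apply: le_trans IH _; rewrite lerD2r ler_piMl ?(ltW sigma0_gt0) //.
  exact: exprn_ile1.
have [] := window_le (leq_addr _ _) bd tB (leqnn _).
rewrite mulSn (addnC T) addnA => bd' _; split=> //.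
apply: le_trans (period_contraction (leq_addr _ _) _) _ => [i /ltnW/bd'/ltW//|].
have := ler_wpM2l rho_ge0 IH; rewrite exprS; lra.
Qed.

(** Write [j = DM + m T + l] with [l < T]. Dividing by [r ^+ (DM + T)] pays for the initial constant
    phase and the incomplete period, where no decay is counted. *)
Lemma solution_bound j :
  enorm (th j) < sigma /\
  enorm (th j) <= sigma0 / r ^+ (DM + T) * r ^+ j + attraction_rate * s.
Proof.
have /andP[r_gt0 /ltW r_le1] := decay_rate_itv.
have rhoT : rho <= r ^+ T.
  have -> : rho = 1 - T%:R * (eps * k * lam / 2) by rewrite /rho /h; ring.
  by apply: bernoulli_ineq; move: r_gt0 r_le1; rewrite /r; lra.
have decay p m : p <= r ^+ m -> (j <= DM + T + m)%N ->
    p * sigma0 <= sigma0 / r ^+ (DM + T) * r ^+ j.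
  move=> pm jm; rewrite mulrC -mulrA ler_wpM2l ?(ltW sigma0_gt0) //.
  rewrite mulrC ler_pdivlMr ?exprn_gt0 //.
  apply: le_trans (ler_wpM2r _ pm) _; first by rewrite exprn_ge0 // ltW.
  by rewrite -exprD addnC ler_wiXn2l // ltW.
have gain_ge0 : 0 <= attraction_rate * s.
  by rewrite mulr_ge0 ?attraction_rate_ge0 // ltW.
have [DMj|/ltnW jDM] := leqP DM j; last first.
  case: thP => _ /(_ _ jDM) thj _; split; first by lra.
  apply: le_trans thj _; have := decay 1 0; rewrite expr0 mul1r addn0.
  by move=> /(_ (lexx _))/(_ (leq_trans jDM (leq_addr _ _))); lra.
have [bd tB] := period_invariant ((j - DM) %/ T).
have lT : ((j - DM) %% T < T)%N by rewrite ltn_mod dither_period_gt0.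
have jE : j = (DM + (j - DM) %/ T * T + (j - DM) %% T)%N.
  by rewrite -addnA -divn_eq subnKC.
have tB' : enorm (th (DM + (j - DM) %/ T * T)%N) <= sigma0 + B * s.
  apply: le_trans tB _; rewrite lerD2r ler_piMl ?(ltW sigma0_gt0) //.
  exact: exprn_ile1.
have [bd' near_t] := window_le (leq_addr _ _) bd tB' (ltnW lT).
rewrite -jE in bd' near_t; split; first exact: bd'.
apply: le_trans (enorm_le_add _ _) (le_trans (lerD tB near_t) _).
rewrite /attraction_rate mulrDl addrA lerD2r lerD2r.
apply: (decay _ (T * ((j - DM) %/ T))%N).
  by rewrite exprM lerXn2r ?nnegrE ?exprn_ge0 // ltW.
by rewrite {1}jE -!addnA leq_add2l addnC mulnC leq_add2r ltnW.
Qed.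

End solution.
End averaging.

(** * The threshold on [eps] and the final assembly *)

Theorem corollary2 (R : realType) (n : nat) (hn : (1 <= n)%N)
  (H : 'M[R]_n) (hH : sym_posdef H) (Qstar : R)
  (sigma0 : R) (hsigma0 : 0 < sigma0)
  (DM : nat) (hDM : (1 <= DM)%N)
  (a : 'I_n -> R) (ha : forall i, 0 < a i)
  (k : R) (hk : 0 < k) :
  (forall i : 'I_n,
     (omega DM i : R -> R^o) =O_ (0^'+) (Num.sqrt : R -> R^o)) /\
  practically_stable DM sigma0 (es_solutions H Qstar sigma0 DM a k).
Proof.
split=> [i|]; first exact: omega_bigO.
have [lam lam0 lamP] := posdef_coercive hH.
pose L := mxsum H; pose kc := k * period_rate R n DM.
pose G := attraction_rate H Qstar sigma0 DM a k lam.
have kc0 : 0 <= kc by rewrite mulr_ge0 ?(ltW hk) ?ler0n.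
have G0 : 0 <= G by exact: attraction_rate_ge0.
have L0 : 0 <= kc * L ^+ 2 / lam.
  by rewrite divr_ge0 ?(ltW lam0) // mulr_ge0 // sqr_ge0.
have kl0 : 0 <= kc * lam by rewrite mulr_ge0 // ltW.
(* Each smallness condition bounds [s] times a summand of [X], so [s X <= 1] yields them all; the
   summand 1 gives [s <= 1] and makes [s G < 1] strict. *)
pose X := 1 + kc * L ^+ 2 / lam + kc * lam + G.
have X0 : 0 < X by rewrite /X; lra.
(* The square turns [eps <= eps_star] into [s <= 1 / X]. The radius uses [G + 1] rather than [G]
   because the ball is open. *)
exists (X^-1 ^+ 2), (sigma0 + 1), (G + 1).
split; [by rewrite exprn_gt0 ?invr_gt0|lra|lra|move=> eps /andP[eps0 epsX]].
set s := Num.sqrt eps; have s0 : 0 < s by rewrite sqrtr_gt0.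
have sX : s * X <= 1.
  rewrite -ler_pdivlMr // div1r -(@ger0_norm _ X^-1) ?invr_ge0 ?(ltW X0) //.
  by rewrite -sqrtr_sqr ler_sqrt // exprn_ge0 // invr_ge0 ltW.
have s1 : s <= 1 by apply: le_trans sX; rewrite ler_peMr ?(ltW s0) // /X; lra.
have sL : s * kc * L ^+ 2 <= lam.
  rewrite -[leRHS]mul1r -ler_pdivrMr //; apply: le_trans sX.
  have -> : s * kc * L ^+ 2 / lam = s * (kc * L ^+ 2 / lam) by ring.
  by rewrite ler_wpM2l ?(ltW s0) // /X; lra.
have slam : s * kc * lam <= 1.
  by apply: le_trans sX; rewrite -mulrA ler_wpM2l ?(ltW s0) // /X; lra.
have sG : s * G < 1.
  by apply: lt_le_trans sX; rewrite ltr_pM2l // /X; lra.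
have bound D th := @solution_bound _ _ H Qstar sigma0 DM a k lam eps
  hn hDM ha hk lam0 eps0 hH lamP hsigma0 s1 sL slam sG D th.
have rP : 0 < 1 - eps * k * lam / 2 < 1 by exact: decay_rate_itv slam.
have /andP[r0 r1] := rP.
split=> [th [D [D_le thP]] j _|]; first by have [] := bound D th D_le thP j.
set r := 1 - _ in bound r0 r1 rP.
(* Both constants depend on [eps] only, not on the delay or the solution. *)
exists (sigma0 / r ^+ (DM + `|dither_period n DM eps|)), r.
split=> // [|th [D [D_le thP]] j]; first by rewrite divr_gt0 ?exprn_gt0.
have [_ thj] := bound D th D_le thP j; apply: edist_eball_le thj.
- by rewrite mulr_ge0 // ltW.
- by rewrite ltr_pM2r // ltrDl.
- by rewrite mulr_ge0 ?divr_ge0 ?exprn_ge0 ?(ltW r0) ?(ltW hsigma0).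
Qed.
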